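(* Let $\mathscr{G}$ be a groupoid and $B=\mathrm{M}_{\Bbbk}(\mathscr{G}_0)$ its base $\Bbbk$-algebra. The map $$\zeta:\mathscr{R}_{\Bbbk}(\mathscr{G})\longrightarrow\mathrm{M}_{\Bbbk}(\mathscr{G}_1),\qquad \overline{\varphi\otimes_{\mathrm{T}_{\mathcal{E}}}p}\longmapsto\Big\{g\mapsto\varphi(\mathsf{t}(g))\big(\varrho^{\mathcal{E}}_g(p(\mathsf{s}(g)))\big)\Big\}$$ is an injective map of $(B\otimes_{\Bbbk}B)$-algebras into the total algebra of $\mathscr{G}$. Moreover: (1) $\iota^*\circ\zeta=\varepsilon$, where $\iota^*:\mathrm{M}_{\Bbbk}(\mathscr{G}_1)\to\mathrm{M}_{\Bbbk}(\mathscr{G}_0)$ is precomposition with $\iota$. (2) $\zeta\big(\mathscr{S}(\overline{\varphi\otimes_{\mathrm{T}_{\mathcal{E}}}p})\big)(g)=\zeta(\overline{\varphi\otimes_{\mathrm{T}_{\mathcal{E}}}p})(g^{-1})$ for every $\overline{\varphi\otimes_{\mathrm{T}_{\mathcal{E}}}p}\in\mathscr{R}_{\Bbbk}(\mathscr{G})$ and $g\in\mathscr{G}_1$. (3) For every pair of arrows $f,g\in\mathscr{G}_1$ with $\mathsf{t}(f)=\mathsf{s}(g)$ and every $F\in\mathscr{R}_{\Bbbk}(\mathscr{G})$, $$\zeta(F)(g\circ f)=\zeta(F_1)(g)\,\zeta(F_2)(f),\quad\text{where }\Delta(F)=F_1\otimes_BF_2\ \text{(summation understood)}.$$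
   Context: $\Bbbk$ is a fixed ground field. For a set $X$, $\mathrm{M}_{\Bbbk}(X)$ is the $\Bbbk$-algebra of all maps $X\to\Bbbk$. **Groupoids.** A (discrete) groupoid $\mathscr{G}$ is a small category with all arrows invertible and nonempty object set $\mathscr{G}_0$; $\mathscr{G}_1$ is the set of arrows, $\mathsf{s},\mathsf{t}:\mathscr{G}_1\to\mathscr{G}_0$ source and target, $\iota:\mathscr{G}_0\to\mathscr{G}_1$ identities; $gh$ is defined when $\mathsf{s}(g)=\mathsf{t}(h)$. $\mathrm{M}_{\Bbbk}(\mathscr{G}_1)$ is the total algebra of $\mathscr{G}$; it is a $(B\otimes_{\Bbbk}B)$-algebra via $(a\otimes b)\mapsto[g\mapsto a(\mathsf{t}(g))b(\mathsf{s}(g))]$. **Representations.** A $\mathscr{G}$-representation $(\mathcal{E},\varrho^{\mathcal{E}})$ is a disjoint union $\mathcal{E}=\bigcup_{x\in\mathscr{G}_0}E_x$ of finite dimensional $\Bbbk$-vector spaces, all isomorphic to one finite dimensional space $V$, with linear isomorphisms $\varrho^{\mathcal{E}}_g:E_{\mathsf{s}(g)}\to E_{\mathsf{t}(g)}$ such that $\varrho^{\mathcal{E}}_{\iota(x)}=\mathrm{id}$ and $\varrho^{\mathcal{E}}_{gh}=\varrho^{\mathcal{E}}_g\varrho^{\mathcal{E}}_h$. A morphism $\alpha$ is a family of linear maps $\alpha_x:E_x\to F_x$ with $\alpha_{\mathsf{t}(g)}\varrho^{\mathcal{E}}_g=\varrho^{\mathcal{F}}_g\alpha_{\mathsf{s}(g)}$.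 The category is $\mathrm{Rep}_{\Bbbk}(\mathscr{G})$ (essentially small); $\mathrm{T}_{\mathcal{E}}=\mathrm{End}(\varrho^{\mathcal{E}})$. Tensor products are fiberwise, duals have fibers $E_x^*$ with action $[(\varrho_g^{\mathcal{E}})^*]^{-1}$, and the unit $\mathcal{I}$ has fibers $\Bbbk$ and identity action. $\Gamma(\mathcal{E})$ is the $B$-module of sections $p$, $p(x)\in E_x$ (finitely generated projective). Put $\Gamma(\mathcal{E})^*=\mathrm{Hom}_B(\Gamma(\mathcal{E}),B)\cong\Gamma(\mathcal{E}^* )$, so $\varphi\in\Gamma(\mathcal{E})^*$ has values $\varphi(x)\in E_x^*$. **Representative functions.** $\mathscr{R}_{\Bbbk}(\mathscr{G})$ is the coend of $\Gamma(-)^*\otimes_{\Bbbk}\Gamma(-)$ over $\mathrm{Rep}_{\Bbbk}(\mathscr{G})$, i.e. the quotient of $\bigoplus_{\mathcal{E}}\Gamma(\mathcal{E})^*\otimes_{\mathrm{T}_{\mathcal{E}}}\Gamma(\mathcal{E})$ by the $(B\otimes_{\Bbbk}B)$-submodule generated by all $\varphi\otimes\alpha s-\varphi\alpha\otimes s$ with $\alpha:\mathcal{E}\to\mathcal{F}$, $\varphi\in\Gamma(\mathcal{F})^*$, $s\in\Gamma(\mathcal{E})$. Write $\overline{\varphi\otimes_{\mathrm{T}_{\mathcal{E}}}p}$ for classes. Structure: $\overline{\varphi\otimes p}\cdot\overline{\psi\otimes q}=\overline{(\varphi\otimes_B\psi)\otimes(p\otimes_Bq)}$ (for $\mathcal{E}\otimes\mathcal{F}$);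 $\mathsf{s}(a)=\overline{1_B\otimes a}$, $\mathsf{t}(a)=\overline{a\otimes1_B}$ (for $\mathcal{I}$), making $\mathscr{R}_{\Bbbk}(\mathscr{G})$ a $(B\otimes_{\Bbbk}B)$-algebra via $a\otimes b\mapsto\mathsf{t}(a)\mathsf{s}(b)$ (and a $B$-bimodule with $\mathsf{t}$ on the left, $\mathsf{s}$ on the right); counit $\varepsilon(\overline{\varphi\otimes p})(x)=\varphi(x)(p(x))$; comultiplication $\Delta(\overline{\varphi\otimes p})=\sum_i\overline{\varphi\otimes s_i}\otimes_B\overline{s_i^*\otimes p}$ for a dual basis $\{s_i,s_i^*\}$ of $\Gamma(\mathcal{E})$; antipode $\mathscr{S}(\overline{\varphi\otimes p})=\overline{\tilde p\otimes\varphi}$ (for $\mathcal{E}^*$, with $\tilde{(-)}:\mathcal{E}\cong\mathcal{E}^{**}$). *)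

(* Defs.v *)
From HB Require Import structures.
From mathcomp Require Import all_boot all_order all_algebra.
From mathcomp Require Import boolp classical_sets functions.

Set Implicit Arguments.
Unset Strict Implicit.
Unset Printing Implicit Defensive.
Import GRing.Theory.
Local Open Scope ring_scope.

(* The coend is a quotient of a sum indexed by *all* representations, hence by
   a type of a universe strictly above those of the MathComp algebraic
   structures; it cannot carry a zmodType structure.  Abelian groups in that
   universe are handled by the following record. *)
Record abgroup := AbGroup {
  ag_car :> Type;
  ag0 : ag_car;
  agD : ag_car -> ag_car -> ag_car;
  agN : ag_car -> ag_car;
  agA : associative agD;
  agC : commutative agD;
  ag0D : left_id ag0 agD;
  agND : left_inverse ag0 agN agD }.
Arguments ag0 {_}.

Definition ab_of (M : zmodType) : abgroup :=
  @AbGroup M 0 +%R -%R (@addrA M) (@addrC M) (@add0r M) (@addNr M).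

Section AbGroupTheory.
Variable A : abgroup.
Implicit Types a b c : A.

Lemma agD0 a : agD a ag0 = a. Proof. by rewrite agC ag0D. Qed.
Lemma agDN a : agD a (agN a) = ag0. Proof. by rewrite agC agND. Qed.
Lemma agKD a b : agD (agN a) (agD a b) = b.
Proof. by rewrite agA agND ag0D. Qed.
Lemma agDI a b c : agD a b = agD a c -> b = c.
Proof. by move=> e; rewrite -(agKD a b) e agKD. Qed.
Lemma agACA a b c d : agD (agD a b) (agD c d) = agD (agD a c) (agD b d).
Proof. by rewrite -!agA; congr agD; rewrite !agA; congr agD; apply: agC. Qed.
Lemma ag_idem a : agD a a = a -> a = ag0.
Proof. by move=> e; apply: (@agDI a); rewrite agD0. Qed.
HB.instance Definition _ := Monoid.isComLaw.Build A ag0 (@agD A)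
  (@agA A) (@agC A) (@ag0D A).
End AbGroupTheory.

Definition additive_map (A C : abgroup) (f : A -> C) :=
  forall a b, f (agD a b) = agD (f a) (f b).

Section AdditiveTheory.
Variables (A C : abgroup) (f : A -> C).
Hypothesis fD : additive_map f.
Lemma addm0 : f ag0 = ag0. Proof. by apply: ag_idem; rewrite -fD ag0D. Qed.
Lemma addmN a : f (agN a) = agN (f a).
Proof. by apply: (@agDI _ (f a)); rewrite -fD !agDN addm0. Qed.
Lemma addm_sum I (l : seq I) (F : I -> A) :
  f (\big[@agD _/ag0]_(i <- l) F i) = \big[@agD _/ag0]_(i <- l) f (F i).
Proof. by elim: l => [|i l IH]; rewrite ?big_nil ?addm0 // !big_cons fD IH. Qed.
End AdditiveTheory.

(* Abelian groups presented by generators and relations.  A formal sum is a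
   list of signed generators, [(false, x)] standing for [+ x] and [(true, x)]
   for [- x]; [pres r] is the quotient of the free abelian group on [X] by the
   subgroup generated by the differences [a - b] with [r a b]. *)
Definition fsum (X : Type) := seq (bool * X).

Inductive pres_eq (X : Type) (r : fsum X -> fsum X -> Prop) :
    fsum X -> fsum X -> Prop :=
| pres_refl a : pres_eq r a a
| pres_sym a b : pres_eq r a b -> pres_eq r b a
| pres_trans a b c : pres_eq r a b -> pres_eq r b c -> pres_eq r a c
| pres_cat a b c d : pres_eq r a b -> pres_eq r c d -> pres_eq r (a ++ c) (b ++ d)
| pres_comm a b : pres_eq r (a ++ b) (b ++ a)
| pres_inv s x : pres_eq r [:: (s, x); (~~ s, x)] [::]
| pres_base a b : r a b -> pres_eq r a b.

Section Presentation.
Variables (X : Type) (r : fsum X -> fsum X -> Prop).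

Definition pres_car := {P : fsum X -> Prop | exists a, P = pres_eq r a}.
Definition pi (a : fsum X) : pres_car :=
  exist _ (pres_eq r a) (ex_intro _ a erefl).

Lemma pres_car_inj (c d : pres_car) : sval c = sval d -> c = d.
Proof.
case: c d => [P p] [Q q] /= e; case: Q / e q => q.
by congr exist; apply: Prop_irrelevance.
Qed.

Lemma piP a b : pi a = pi b <-> pres_eq r a b.
Proof.
split=> [/(congr1 sval) /= -> |ab]; first exact: pres_refl.
apply: pres_car_inj => /=; apply: funext => c; apply: propext; split=> h.
  exact: pres_trans (pres_sym ab) h.
exact: pres_trans ab h.
Qed.

Definition repr_fsum (c : pres_car) : fsum X := sval (cid (svalP c)).

Lemma repr_fsumK c : pi (repr_fsum c) = c.
Proof. by rewrite /repr_fsum; case: cid => a /= e; apply: pres_car_inj. Qed.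

Lemma repr_fsumP a : pres_eq r (repr_fsum (pi a)) a.
Proof. by apply/piP; apply: repr_fsumK. Qed.

Definition fopp (a : fsum X) : fsum X := [seq (~~ u.1, u.2) | u <- a].

Lemma pres_catACA a b c d :
  pres_eq r ((a ++ b) ++ (c ++ d)) ((a ++ c) ++ (b ++ d)).
Proof.
rewrite -!catA; apply: pres_cat; first exact: pres_refl.
rewrite !catA; apply: pres_cat; last exact: pres_refl.
exact: pres_comm.
Qed.

Lemma pres_fopp a : pres_eq r (fopp a ++ a) [::].
Proof.
elim: a => [|[s x] a IH] /=; first exact: pres_refl.
apply: pres_trans (pres_catACA [:: _] (fopp a) [:: _] a) _.
rewrite -[[::]]/([::] ++ [::]); apply: pres_cat => //.
by rewrite -{2}[s]negbK; apply: pres_inv.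
Qed.

Lemma pres_fopp_congr a b : pres_eq r a b -> pres_eq r (fopp a) (fopp b).
Proof.
move=> ab; apply: (@pres_trans _ _ _ (fopp a ++ (b ++ fopp b))).
  rewrite -{1}[fopp a]cats0; apply: pres_cat; first exact: pres_refl.
  apply: pres_sym; apply: pres_trans (pres_comm _ _ _) (pres_fopp b).
rewrite catA -{2}[fopp b]cat0s; apply: pres_cat; last exact: pres_refl.
apply: pres_trans (pres_fopp a); apply: pres_cat; first exact: pres_refl.
exact: pres_sym.
Qed.

Definition presD (c d : pres_car) := pi (repr_fsum c ++ repr_fsum d).
Definition presN (c : pres_car) := pi (fopp (repr_fsum c)).

Lemma piD a b : presD (pi a) (pi b) = pi (a ++ b).
Proof. by apply/piP; apply: pres_cat; apply: repr_fsumP. Qed.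

Lemma piN a : presN (pi a) = pi (fopp a).
Proof. by apply/piP; apply: pres_fopp_congr; apply: repr_fsumP. Qed.

Lemma pres_ind (P : pres_car -> Prop) : (forall a, P (pi a)) -> forall c, P c.
Proof. by move=> h c; rewrite -(repr_fsumK c). Qed.

Fact presA : associative presD.
Proof.
elim/pres_ind=> a; elim/pres_ind=> b; elim/pres_ind=> c.
by rewrite !piD catA.
Qed.

Fact presC : commutative presD.
Proof.
elim/pres_ind=> a; elim/pres_ind=> b; rewrite !piD.
by apply/piP; apply: pres_comm.
Qed.

Fact pres0D : left_id (pi [::]) presD.
Proof. by elim/pres_ind=> a; rewrite piD. Qed.

Fact presND : left_inverse (pi [::]) presN presD.
Proof.
by elim/pres_ind=> a; rewrite piN piD; apply/piP; apply: pres_fopp.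
Qed.

Definition pres : abgroup := AbGroup presA presC pres0D presND.

Definition gencls (x : X) : pres := pi [:: (false, x)].

(* The additive map out of [pres r] with prescribed values on generators; it
   has these values as soon as they respect the relations, see [extE]. *)
Section Extension.
Variables (A : abgroup) (f : X -> A).

Definition fsum_eval (a : fsum X) : A :=
  foldr (fun u z => agD (if u.1 then agN (f u.2) else f u.2) z) ag0 a.

Definition ext (c : pres) : A := fsum_eval (repr_fsum c).

Definition respects := forall a b, r a b -> fsum_eval a = fsum_eval b.

Lemma fsum_eval_cat a b : fsum_eval (a ++ b) = agD (fsum_eval a) (fsum_eval b).
Proof. by elim: a => [|u a IH] /=; rewrite ?ag0D // IH agA. Qed.

Hypothesis fr : respects.

Lemma fsum_eval_pres a b : pres_eq r a b -> fsum_eval a = fsum_eval b.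
Proof.
elim=> {a b} [||a b c _ + _|a b c d _ + _|a b|[] x|] //=.
- by move=> -> ->.
- by rewrite !fsum_eval_cat => -> ->.
- by rewrite !fsum_eval_cat agC.
- by rewrite agD0 agND.
- by rewrite agD0 agDN.
Qed.

Lemma ext_pi a : ext (pi a) = fsum_eval a.
Proof. exact: fsum_eval_pres (repr_fsumP a). Qed.

Lemma extE x : ext (gencls x) = f x.
Proof. by rewrite ext_pi /= agD0. Qed.

Lemma extD : additive_map ext.
Proof.
by elim/pres_ind=> a; elim/pres_ind=> b; rewrite /= piD !ext_pi fsum_eval_cat.
Qed.
End Extension.

Lemma pres_gen_ind (P : pres -> Prop) :
    P ag0 -> (forall x, P (gencls x)) -> (forall c, P c -> P (agN c)) ->
    (forall c d, P c -> P d -> P (agD c d)) -> forall c, P c.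
Proof.
move=> P0 Pg PN PD; elim/pres_ind; elim=> [//|[s x] a IH].
have -> : pi ((s, x) :: a) = agD (pi [:: (s, x)] : pres) (pi a) by rewrite /= piD.
apply: PD => //; case: s; last exact: Pg.
by have := PN _ (Pg x); rewrite /= piN.
Qed.

Lemma additive_ext_eq (A : abgroup) (f g : pres -> A) :
  additive_map f -> additive_map g ->
  (forall x, f (gencls x) = g (gencls x)) -> f =1 g.
Proof.
move=> fD gD fg; elim/pres_gen_ind => [|x|c|c d].
- by rewrite !addm0.
- exact: fg.
- by rewrite (addmN fD) (addmN gD) => ->.
- by rewrite fD gD => -> ->.
Qed.

End Presentation.
Arguments pres [X] r.
Arguments gencls [X r] x.
Arguments pi [X r] a.

(* The tensor product over a commutative ring with elements [S] of [M] and [N],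
   [rM] and [lN] being the actions of [S] used for the balancing. *)
Section Tensor.
Variables (S : Type) (M N : abgroup) (rM : M -> S -> M) (lN : S -> N -> N).

Inductive tensor_rel : fsum (M * N) -> fsum (M * N) -> Prop :=
| tensor_relDl m m' n :
    tensor_rel [:: (false, (agD m m', n))] [:: (false, (m, n)); (false, (m', n))]
| tensor_relDr m n n' :
    tensor_rel [:: (false, (m, agD n n'))] [:: (false, (m, n)); (false, (m, n'))]
| tensor_relZ m a n :
    tensor_rel [:: (false, (rM m a, n))] [:: (false, (m, lN a n))].

Definition tensor : abgroup := pres tensor_rel.
Definition tens (m : M) (n : N) : tensor := gencls (m, n).

Lemma tensDl m m' n : tens (agD m m') n = agD (tens m n) (tens m' n).
Proof.
by rewrite /= piD; apply/piP; apply: pres_base; apply: tensor_relDl.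
Qed.
Lemma tensDr m n n' : tens m (agD n n') = agD (tens m n) (tens m n').
Proof.
by rewrite /= piD; apply/piP; apply: pres_base; apply: tensor_relDr.
Qed.
Lemma tensZ m a n : tens (rM m a) n = tens m (lN a n).
Proof. by apply/piP; apply: pres_base; apply: tensor_relZ. Qed.

Lemma tensor_respects (A : abgroup) (f : M * N -> A) :
    (forall n, additive_map (fun m => f (m, n))) ->
    (forall m, additive_map (fun n => f (m, n))) ->
    (forall m a n, f (rM m a, n) = f (m, lN a n)) ->
  respects tensor_rel f.
Proof.
by move=> fl fr fb _ _ [m m' n|m n n'|m a n] /=; rewrite !agD0 ?fl ?fr ?fb.
Qed.
End Tensor.

Definition sum_tens (S : Type) (M N : abgroup) rM lN (l : seq (M * N)) : 
    @tensor S M N rM lN :=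
  \big[@agD _/ag0]_(u <- l) tens rM lN u.1 u.2.

Record groupoid := Groupoid {
  ob : Type;
  ghom : ob -> ob -> Type;
  gid : forall x, ghom x x;
  gcmp : forall x y z, ghom y z -> ghom x y -> ghom x z;
  ginv : forall x y, ghom x y -> ghom y x;
  gcmpA : forall w x y z (h : ghom y z) (g : ghom x y) (f : ghom w x),
    gcmp h (gcmp g f) = gcmp (gcmp h g) f;
  gcmp1m : forall x y (g : ghom x y), gcmp (gid y) g = g;
  gcmpm1 : forall x y (g : ghom x y), gcmp g (gid x) = g;
  gcmpVm : forall x y (g : ghom x y), gcmp (ginv g) g = gid x;
  gcmpmV : forall x y (g : ghom x y), gcmp g (ginv g) = gid y;
  ob_inhabited : inhabited ob }.

Record arrow (G : groupoid) := Arrow {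
  src : ob G;
  tgt : ob G;
  arr : ghom src tgt }.

Section GroupoidTheory.
Variable G : groupoid.

Lemma gcmpI x y z (h : ghom y z) (f g : @ghom G x y) :
  gcmp h f = gcmp h g -> f = g.
Proof.
by move=> e; rewrite -(gcmp1m f) -(gcmpVm h) -gcmpA e gcmpA gcmpVm gcmp1m.
Qed.

Lemma ginv_id (x : ob G) : ginv (gid x) = gid x.
Proof. by rewrite -[LHS]gcmpm1 gcmpVm. Qed.

Lemma ginv_cmp x y z (g : ghom y z) (f : @ghom G x y) :
  ginv (gcmp g f) = gcmp (ginv f) (ginv g).
Proof.
apply: (@gcmpI _ _ _ (gcmp g f)).
by rewrite gcmpmV -gcmpA (gcmpA f) gcmpmV gcmp1m gcmpmV.
Qed.

Definition arrow_inv (g : arrow G) : arrow G := Arrow (ginv (arr g)).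
Definition arrow_id (x : ob G) : arrow G := Arrow (gid x).
End GroupoidTheory.

Section LinearAlgebra.
Variable k : fieldType.
Implicit Types U V W : vectType k.

Definition dualV V : vectType k := 'Hom(V, k^o).

Section Precomp.
Variables (U V W : vectType k) (a : 'Hom(U, V)).
Definition precomp_fun (f : 'Hom(V, W)) : 'Hom(U, W) := (f \o a)%VF.
Fact precomp_is_linear : linear precomp_fun.
Proof. by move=> c f g; apply/lfunP => u; rewrite !(comp_lfunE, add_lfunE, scale_lfunE). Qed.
HB.instance Definition _ :=
  GRing.isLinear.Build k 'Hom(V, W) 'Hom(U, W) _ precomp_fun precomp_is_linear.
Definition precomp : 'Hom('Hom(V, W), 'Hom(U, W)) := linfun precomp_fun.
Lemma precompE f : precomp f = (f \o a)%VF.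
Proof. by rewrite lfunE. Qed.
End Precomp.

Definition transpose V W (a : 'Hom(V, W)) : 'Hom(dualV W, dualV V) :=
  precomp k^o a.

(* MathComp has no tensor product of vector spaces; for finite dimensional [V]
   the space of linear maps [V^* -> W] is one, [v (x) w] being the map
   [f |-> f(v) w]; see [tensV_universal]. *)
Definition tensV V W : vectType k := 'Hom(dualV V, W).

Section Pure.
Variables (V W : vectType k) (v : V) (w : W).
Definition pure_fun (f : dualV V) : W := (f v : k) *: w.
Fact pure_is_linear : linear pure_fun.
Proof. by move=> c f g; rewrite /pure_fun add_lfunE scale_lfunE scalerDl scalerA. Qed.
HB.instance Definition _ := GRing.isLinear.Build k (dualV V) W _ pure_fun pure_is_linear.
Definition pure : tensV V W := linfun pure_fun.
Lemma pureE f : pure f = (f v : k) *: w.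
Proof. by rewrite lfunE. Qed.
End Pure.

Section Tmap.
Variables (V V' W W' : vectType k) (a : 'Hom(V, V')) (b : 'Hom(W, W')).
Definition tmap_fun (T : tensV V W) : tensV V' W' := (b \o T \o transpose a)%VF.
Fact tmap_is_linear : linear tmap_fun.
Proof.
move=> c S T; apply/lfunP => f.
by rewrite !(comp_lfunE, add_lfunE, scale_lfunE) linearP.
Qed.
HB.instance Definition _ :=
  GRing.isLinear.Build k (tensV V W) (tensV V' W') _ tmap_fun tmap_is_linear.
Definition tmap : 'Hom(tensV V W, tensV V' W') := linfun tmap_fun.
Lemma tmapE T f : tmap T f = b (T (f \o a)%VF).
Proof. by rewrite lfunE /= /tmap_fun !comp_lfunE /= precompE. Qed.
End Tmap.

Section Tpair.
Variables (V W : vectType k) (f : dualV V) (g : dualV W).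
Definition tpair_fun (T : tensV V W) : k^o := g (T f).
Fact tpair_is_linear : linear tpair_fun.
Proof. by move=> c S T; rewrite /tpair_fun add_lfunE scale_lfunE linearP. Qed.
HB.instance Definition _ :=
  GRing.isLinear.Build k (tensV V W) k^o _ tpair_fun tpair_is_linear.
(* [f (x) g], as a linear form on [V (x) W]. *)
Definition tpair : dualV (tensV V W) := linfun tpair_fun.
Lemma tpairE T : tpair T = g (T f).
Proof. by rewrite lfunE. Qed.
End Tpair.

Lemma tmap_pure V V' W W' (a : 'Hom(V, V')) (b : 'Hom(W, W')) v w :
  tmap a b (pure v w) = pure (a v) (b w).
Proof.
by apply/lfunP => f; rewrite tmapE !pureE linearZ /= comp_lfunE.
Qed.

Lemma tpair_pure V W (f : dualV V) (g : dualV W) v w :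
  tpair f g (pure v w) = (f v : k) * g w :> k.
Proof. by rewrite tpairE pureE linearZ. Qed.

Section Bidual.
Variables (V : vectType k) (v : V).
Definition evalV_fun (f : dualV V) : k^o := f v.
Fact evalV_is_linear : linear evalV_fun.
Proof. by move=> c f g; rewrite /evalV_fun add_lfunE scale_lfunE. Qed.
HB.instance Definition _ :=
  GRing.isLinear.Build k (dualV V) k^o _ evalV_fun evalV_is_linear.
Definition evalV : dualV (dualV V) := linfun evalV_fun.
Lemma evalVE f : evalV f = f v.
Proof. by rewrite lfunE. Qed.
End Bidual.

Section DualBasis.
Variable V : vectType k.
Let n := \dim {:V}.
Definition bas (i : 'I_n) : V := (vbasis {:V})`_i.
Definition cobas (i : 'I_n) : dualV V := linfun (coord (vbasis {:V}) i : V -> k^o).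
Lemma basE v : v = \sum_i (cobas i v : k) *: bas i.
Proof.
rewrite [LHS](coord_vbasis (memvf v)); apply: eq_bigr => i _.
by rewrite lfunE.
Qed.
Lemma cobasE (f : dualV V) : f = \sum_i (f (bas i) : k) *: cobas i.
Proof.
apply/lfunP => v; rewrite {1}[v]basE linear_sum sum_lfunE.
by apply: eq_bigr => i _; rewrite linearZ scale_lfunE lfunE /=; apply: mulrC.
Qed.
End DualBasis.

Lemma tens_pure V W (T : tensV V W) : T = \sum_i pure (bas i) (T (cobas i)).
Proof.
apply/lfunP => f; rewrite {1}[f]cobasE linear_sum sum_lfunE.
by apply: eq_bigr => i _; rewrite linearZ pureE.
Qed.

Section Universal.
Variables (V W U : vectType k) (b : V -> W -> U).
Hypotheses (bl : forall w, linear (b^~ w)) (br : forall v, linear (b v)).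
Let brL v : {linear W -> U} :=
  HB.pack (b v) (GRing.isLinear.Build k W U _ (b v) (br v)).
Let blL w : {linear V -> U} :=
  HB.pack (b^~ w) (GRing.isLinear.Build k V U _ (b^~ w) (bl w)).
Let h_fun (T : tensV V W) : U := \sum_i b (bas i) (T (cobas i)).
Fact h_is_linear : linear h_fun.
Proof.
move=> c S T; rewrite /h_fun scaler_sumr -big_split /=; apply: eq_bigr => i _.
by rewrite add_lfunE scale_lfunE br.
Qed.
HB.instance Definition _ := GRing.isLinear.Build k (tensV V W) U _ h_fun h_is_linear.

Lemma tensV_universal :
  exists! h : 'Hom(tensV V W, U), forall v w, h (pure v w) = b v w.
Proof.
exists (linfun h_fun); split=> [v w|h hE].
  rewrite lfunE /= /h_fun {2}[v]basE -[RHS]/(blL w _) linear_sum.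
  apply: eq_bigr => i _; rewrite pureE linearZ /=.
  by rewrite -[LHS]/(brL _ _) linearZ.
apply/lfunP => T; rewrite lfunE /= [in RHS](tens_pure T) linear_sum.
by apply: eq_bigr => i _; rewrite /= hE.
Qed.
End Universal.

Lemma tmap1 V W : tmap \1%VF \1%VF = \1%VF :> 'Hom(tensV V W, _).
Proof. by apply/lfunP => T; apply/lfunP => f; rewrite tmapE comp_lfun1r !id_lfunE. Qed.

Lemma tmap_comp V V' V'' W W' W'' (a : 'Hom(V, V')) (a' : 'Hom(V', V''))
    (b : 'Hom(W, W')) (b' : 'Hom(W', W'')) :
  tmap (a' \o a)%VF (b' \o b)%VF = (tmap a' b' \o tmap a b)%VF.
Proof.
apply/lfunP => T; apply/lfunP => f.
by rewrite comp_lfunE !tmapE !comp_lfunE comp_lfunA.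
Qed.

End LinearAlgebra.

(* The maps [act g] are automatically isomorphisms, with inverses
   [act (ginv g)]. *)
Record rep (k : fieldType) (G : groupoid) := Rep {
  fib :> ob G -> vectType k;
  act : forall x y, ghom x y -> 'Hom(fib x, fib y);
  fib_iso : exists V : vectType k, forall x,
    exists f : 'Hom(fib x, V), bijective f;
  act1 : forall x, act (gid x) = \1%VF;
  actM : forall x y z (g : ghom y z) (f : ghom x y),
    act (gcmp g f) = (act g \o act f)%VF }.

Record rmor (k : fieldType) (G : groupoid) (E F : rep k G) := Rmor {
  mor :> forall x, 'Hom(E x, F x);
  mor_nat : forall x y (g : ghom x y),
    (mor y \o act E g)%VF = (act F g \o mor x)%VF }.

Section Representations.
Variables (k : fieldType) (G : groupoid).
Implicit Types E F : rep k G.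

Lemma lfun_bij_inv (V W : vectType k) (f : 'Hom(V, W)) :
  bijective f -> exists2 g : 'Hom(W, V), (g \o f)%VF = \1%VF & (f \o g)%VF = \1%VF.
Proof.
move=> [h fK hK].
have f0 : lker f == 0%VS by apply/lker0P; apply: can_inj fK.
exists (f^-1)%VF; first exact: lker0_compVf.
apply/lfunP => w; rewrite -[w]hK comp_lfunE id_lfunE.
by rewrite -(comp_lfunE (f^-1)%VF) lker0_compVf // id_lfunE.
Qed.

Lemma lfun_inv_bij (V W : vectType k) (f : 'Hom(V, W)) (g : 'Hom(W, V)) :
  (g \o f)%VF = \1%VF -> (f \o g)%VF = \1%VF -> bijective f.
Proof.
move=> gf fg; exists g => v; first by rewrite -comp_lfunE gf id_lfunE.
by rewrite -comp_lfunE fg id_lfunE.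
Qed.

Fact unit_iso : exists V : vectType k, forall x : ob G,
  exists f : 'Hom(k^o, V), bijective f.
Proof. by exists k^o => _; exists \1%VF; exists id => v; rewrite id_lfunE. Qed.

Definition rep_unit : rep k G :=
  @Rep k G (fun=> k^o) (fun _ _ _ => \1%VF) unit_iso
    (fun=> erefl) (fun _ _ _ _ _ => esym (comp_lfun1l _)).

Section Dual.
Variable E : rep k G.
(* The transpose of [act (ginv g)] is the inverse of the transpose of [act g]. *)
Definition dual_act x y (g : ghom x y) : 'Hom(dualV (E x), dualV (E y)) :=
  transpose (act E (ginv g)).
Fact dual_iso : exists V : vectType k, forall x,
  exists f : 'Hom(dualV (E x), V), bijective f.
Proof.
have [V fV] := fib_iso E; exists (dualV V) => x.
have [f /lfun_bij_inv [g gf fg]] := fV x.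
exists (transpose g); apply: (@lfun_inv_bij _ _ _ (transpose f)).
  by apply/lfunP => h; rewrite comp_lfunE id_lfunE !precompE -comp_lfunA gf comp_lfun1r.
by apply/lfunP => h; rewrite comp_lfunE id_lfunE !precompE -comp_lfunA fg comp_lfun1r.
Qed.
Fact dual_act1 x : dual_act (gid x) = \1%VF.
Proof.
by apply/lfunP => f; rewrite precompE ginv_id act1 comp_lfun1r id_lfunE.
Qed.
Fact dual_actM x y z (g : ghom y z) (f : ghom x y) :
  dual_act (gcmp g f) = (dual_act g \o dual_act f)%VF.
Proof.
apply/lfunP => h; rewrite comp_lfunE !precompE ginv_cmp actM.
by rewrite comp_lfunA.
Qed.
Definition rep_dual : rep k G := Rep dual_iso dual_act1 dual_actM.

Lemma dual_actV x y (g : ghom x y) :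
  (dual_act g \o transpose (act E g))%VF = \1%VF /\
  (transpose (act E g) \o dual_act g)%VF = \1%VF.
Proof.
by split; apply/lfunP => f; rewrite comp_lfunE !precompE -comp_lfunA -actM
  ?gcmpVm ?gcmpmV act1 comp_lfun1r id_lfunE.
Qed.
End Dual.

Section TensorRep.
Variables E F : rep k G.
Fact tensor_iso : exists V : vectType k, forall x,
  exists f : 'Hom(tensV (E x) (F x), V), bijective f.
Proof.
have [V fV] := fib_iso E; have [W gW] := fib_iso F.
exists (tensV V W) => x.
have [f /lfun_bij_inv [f' ff1 ff2]] := fV x.
have [g /lfun_bij_inv [g' gg1 gg2]] := gW x.
exists (tmap f g); apply: (@lfun_inv_bij _ _ _ (tmap f' g')).
  by rewrite -tmap_comp ff1 gg1 tmap1.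
by rewrite -tmap_comp ff2 gg2 tmap1.
Qed.
Fact tensor_act1 x : tmap (act E (gid x)) (act F (gid x)) = \1%VF.
Proof. by rewrite !act1 tmap1. Qed.
Fact tensor_actM x y z (g : ghom y z) (f : ghom x y) :
  tmap (act E (gcmp g f)) (act F (gcmp g f)) =
  (tmap (act E g) (act F g) \o tmap (act E f) (act F f))%VF.
Proof. by rewrite !actM tmap_comp. Qed.
Definition rep_tensor : rep k G :=
  @Rep k G (fun x => tensV (E x) (F x)) (fun x y g => tmap (act E g) (act F g))
    tensor_iso tensor_act1 tensor_actM.
End TensorRep.

End Representations.

Section Sections.
Variables (k : fieldType) (G : groupoid).
Local Notation B := (ob G -> k).
Implicit Types E F H : rep k G.

Definition sect E : Type := forall x, E x.
HB.instance Definition _ E := gen_eqMixin (sect E).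
HB.instance Definition _ E := gen_choiceMixin (sect E).

Section SectMod.
Variable E : rep k G.
Implicit Types p q : sect E.
Definition sect0 : sect E := fun x => 0.
Definition sectD p q : sect E := fun x => p x + q x.
Definition sectN p : sect E := fun x => - p x.
Definition sectZ (a : B) p : sect E := fun x => a x *: p x.
Fact sectDA : associative sectD.
Proof. by move=> p q s; apply: functional_extensionality_dep => x; apply: addrA. Qed.
Fact sectDC : commutative sectD.
Proof. by move=> p q; apply: functional_extensionality_dep => x; apply: addrC. Qed.
Fact sect0D : left_id sect0 sectD.
Proof. by move=> p; apply: functional_extensionality_dep => x; apply: add0r. Qed.
Fact sectND : left_inverse sect0 sectN sectD.
Proof. by move=> p; apply: functional_extensionality_dep => x; apply: addNr. Qed.
HB.instance Definition _ :=
  GRing.isZmodule.Build (sect E) sectDA sectDC sect0D sectND.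
Fact sectZA (a b : B) p : sectZ a (sectZ b p) = sectZ (a * b) p.
Proof. by apply: functional_extensionality_dep => x; apply: scalerA. Qed.
Fact sectZ1 : left_id (1 : B) sectZ.
Proof. by move=> p; apply: functional_extensionality_dep => x; apply: scale1r. Qed.
Fact sectZDr : right_distributive sectZ +%R.
Proof. by move=> a p q; apply: functional_extensionality_dep => x; apply: scalerDr. Qed.
Fact sectZDl p : {morph sectZ^~ p : a b / a + b}.
Proof. by move=> a b; apply: functional_extensionality_dep => x; apply: scalerDl. Qed.
HB.instance Definition _ :=
  GRing.Zmodule_isLmodule.Build B (sect E) sectZA sectZ1 sectZDr sectZDl.
End SectMod.

Lemma sectP E (p q : sect E) : (forall x, p x = q x) -> p = q.
Proof. exact: functional_extensionality_dep. Qed.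

Lemma sect_sum E I (l : seq I) (f : I -> sect E) x :
  (\sum_(i <- l) f i) x = \sum_(i <- l) f i x.
Proof. by elim: l => [|i l IH]; rewrite ?big_nil // !big_cons -IH. Qed.

(* [Hom_B(Gamma(E), B)] *)
Definition dsect E := {linear sect E -> B^o}.

Lemma dsectP E (f g : dsect E) : f =1 g -> f = g.
Proof.
case: f g => f cf [g cg] /= /funext fg; case: g / fg cg => cg.
congr GRing.Linear.Pack; case: cf cg => [[a1] [a2]] [[c1] [c2]].
by rewrite (Prop_irrelevance a1 c1) (Prop_irrelevance a2 c2).
Qed.

Section AtPoint.
Variables (E : rep k G) (x : ob G).
Definition at_point (v : E x) : sect E := fun y =>
  if pselect (x = y) is left e then eq_rect x (fun z => E z) v y e else 0.

Lemma at_pointE v : at_point v x = v.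
Proof.
rewrite /at_point; case: pselect => // e.
by rewrite (Prop_irrelevance e erefl).
Qed.

Lemma at_pointN v y : x <> y -> at_point v y = 0.
Proof. by rewrite /at_point; case: pselect. Qed.

Definition dval_fun (f : dsect E) (v : E x) : k^o := f (at_point v) x.

Fact dval_is_linear f : linear (dval_fun f).
Proof.
move=> c v w; rewrite /dval_fun.
have -> : at_point (c *: v + w) = (cst c : B) *: at_point v + at_point w.
  apply: sectP => y; case: (pselect (x = y)) => [e|ne].
    by case: y / e; rewrite -[RHS]/(c *: at_point v x + at_point w x) !at_pointE.
  rewrite -[RHS]/(c *: at_point v y + at_point w y) !at_pointN //.
  by rewrite scaler0 addr0.
by rewrite linearP.
Qed.
HB.instance Definition _ f :=
  GRing.isLinear.Build k (E x) k^o _ (dval_fun f) (dval_is_linear f).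
End AtPoint.

Section DualSections.
Variable E : rep k G.

(* The isomorphism [Gamma(E)^* = Gamma(E^* )]: [dval f x] is the value in
   [E_x^*] of [f], and [dsect_of] is the inverse of [dval]. *)
Definition dval (f : dsect E) : sect (rep_dual E) :=
  fun x => linfun (dval_fun f : E x -> k^o).

Definition dsect_of_fun (u : sect (rep_dual E)) (p : sect E) : B^o :=
  fun x => u x (p x).
Fact dsect_of_is_linear u : linear (dsect_of_fun u).
Proof.
move=> a p q; apply: funext => x.
by rewrite /dsect_of_fun -[LHS]/(u x (a x *: p x + q x)) linearP.
Qed.
HB.instance Definition _ u :=
  GRing.isLinear.Build B (sect E) B^o _ (dsect_of_fun u) (dsect_of_is_linear u).
Definition dsect_of (u : sect (rep_dual E)) : dsect E := dsect_of_fun u.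

Lemma dvalE (f : dsect E) (p : sect E) x : dval f x (p x) = f p x.
Proof.
rewrite lfunE /= /dval_fun.
pose e : B := fun y => (`[< x = y >])%:R.
have -> : at_point (p x) = e *: p.
  apply: sectP => y; rewrite -[RHS]/(e y *: p y) /e; case: (pselect (x = y)) => [xy|ne].
    by case: y / xy; rewrite at_pointE asboolT // scale1r.
  by rewrite at_pointN // asboolF // scale0r.
rewrite linearZ -[LHS]/(e x * f p x) /e asboolT //; exact: mul1r.
Qed.

Lemma dval_at (f : dsect E) x (v : E x) : dval f x v = f (at_point v) x.
Proof. by rewrite lfunE. Qed.

Lemma dvalK : cancel dval dsect_of.
Proof. by move=> f; apply: dsectP => p; apply: funext => x; apply: dvalE. Qed.

Lemma dsect_ofK : cancel dsect_of dval.
Proof.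
move=> u; apply: sectP => x; apply/lfunP => v.
by rewrite dval_at /= /dsect_of_fun at_pointE.
Qed.

Definition dsectD (f g : dsect E) : dsect E := f \+ g.
Definition dsectZ (a : B) (f : dsect E) : dsect E := a \*: f.

Lemma dsect_ext (f g : dsect E) :
  (forall x (v : E x), dval f x v = dval g x v) -> f = g.
Proof.
by move=> fg; rewrite -[f]dvalK -[g]dvalK; congr dsect_of;
   apply: sectP => x; apply/lfunP.
Qed.

Lemma dval_of u x v : dval (dsect_of u) x v = u x v.
Proof. by rewrite dsect_ofK. Qed.
Lemma dvalD f g x v : dval (dsectD f g) x v = dval f x v + dval g x v.
Proof. by rewrite !dval_at. Qed.
Lemma dvalZ a f x v : dval (dsectZ a f) x v = a x * dval f x v.
Proof. by rewrite !dval_at. Qed.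
End DualSections.

Section Morphisms.
Variables (E F : rep k G) (al : rmor E F).
Definition sect_map (p : sect E) : sect F := fun x => al x (p x).
Fact sect_map_is_linear : linear sect_map.
Proof. by move=> a p q; apply: sectP => x; apply: linearP. Qed.
HB.instance Definition _ :=
  GRing.isLinear.Build B (sect E) (sect F) _ sect_map sect_map_is_linear.
Definition dsect_map (f : dsect F) : dsect E := f \o sect_map.
Lemma dval_map f x v : dval (dsect_map f) x v = dval f x (al x v).
Proof.
rewrite [LHS]dval_at /= -dvalE; congr (dval f x _).
by rewrite /sect_map at_pointE.
Qed.
End Morphisms.

Definition sect_tensor E F (p : sect E) (q : sect F) : sect (rep_tensor E F) :=
  fun x => pure (p x) (q x).
Definition dsect_tensor E F (f : dsect E) (g : dsect F) : dsect (rep_tensor E F) :=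
  dsect_of (fun x => tpair (dval f x) (dval g x) : rep_dual (rep_tensor E F) x).

Lemma dval_tensor E F (f : dsect E) (g : dsect F) x T :
  dval (dsect_tensor f g) x T = dval g x (T (dval f x)).
Proof. by rewrite dval_of tpairE. Qed.

(* The coend.  Bilinearity and the case [F = E] of [coend_dinat] give the direct
   sum of the tensor products over the rings [T_E = End(E)]; the elements
   equated by [coend_dinat] are stable under [a (x) b], which maps the pair
   (al, f, s) to (al, a f, b s), so the subgroup they generate is a
   sub-(B (x) B)-module. *)
Record coend_gen := CoendGen {
  gen_rep : rep k G;
  gen_dsect : dsect gen_rep;
  gen_sect : sect gen_rep }.

Inductive coend_rel : fsum coend_gen -> fsum coend_gen -> Prop :=
| coend_Dl E (f f' : dsect E) (p : sect E) :
    coend_rel [:: (false, CoendGen (dsectD f f') p)]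
              [:: (false, CoendGen f p); (false, CoendGen f' p)]
| coend_Dr E (f : dsect E) (p p' : sect E) :
    coend_rel [:: (false, CoendGen f (p + p'))]
              [:: (false, CoendGen f p); (false, CoendGen f p')]
| coend_dinat E F (al : rmor E F) (f : dsect F) (p : sect E) :
    coend_rel [:: (false, CoendGen f (sect_map al p))]
              [:: (false, CoendGen (dsect_map al f) p)].

Definition repfun : abgroup := pres coend_rel.
Definition cls E (f : dsect E) (p : sect E) : repfun := gencls (CoendGen f p).

End Sections.

Section HopfAlgebroid.
Variables (k : fieldType) (G : groupoid).
Local Notation B := (ob G -> k).
Local Notation R := (repfun k G).
Implicit Types (E F H : rep k G) (a b : B).

Lemma clsDl E (f f' : dsect E) p :
  cls (dsectD f f') p = agD (cls f p) (cls f' p).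
Proof. by rewrite /= piD; apply/piP; apply: pres_base; apply: coend_Dl. Qed.
Lemma clsDr E (f : dsect E) p p' : cls f (p + p') = agD (cls f p) (cls f p').
Proof. by rewrite /= piD; apply/piP; apply: pres_base; apply: coend_Dr. Qed.
Lemma cls_dinat E F (al : rmor E F) (f : dsect F) p :
  cls f (sect_map al p) = cls (dsect_map al f) p.
Proof. by apply/piP; apply: pres_base; apply: coend_dinat. Qed.

Lemma coend_respects (A : abgroup) (f : coend_gen k G -> A) :
    (forall E (g g' : dsect E) p,
       f (CoendGen (dsectD g g') p) = agD (f (CoendGen g p)) (f (CoendGen g' p))) ->
    (forall E (g : dsect E) p p',
       f (CoendGen g (p + p')) = agD (f (CoendGen g p)) (f (CoendGen g p'))) ->
    (forall E F (al : rmor E F) (g : dsect F) p,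
       f (CoendGen g (sect_map al p)) = f (CoendGen (dsect_map al g) p)) ->
  respects (@coend_rel k G) f.
Proof.
by move=> fl fr fd _ _ [E g g' p|E g p p'|E F al g p] /=; rewrite !agD0 ?fl ?fr ?fd.
Qed.

Fact rmor_id_nat E x y (g : ghom x y) :
  (\1 \o act E g)%VF = (act E g \o \1)%VF.
Proof. by rewrite comp_lfun1l comp_lfun1r. Qed.
Definition rmor_id E : rmor E E := @Rmor _ _ E E (fun x => \1%VF) (@rmor_id_nat E).

Fact rmor_scale_nat c E x y (g : ghom x y) :
  ((c *: \1) \o act E g)%VF = (act E g \o (c *: \1))%VF.
Proof. by rewrite -comp_lfunZl -comp_lfunZr comp_lfun1l comp_lfun1r. Qed.
Definition rmor_scale c E : rmor E E := @Rmor _ _ E E (fun x => c *: \1%VF) (@rmor_scale_nat c E).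

Section RmorTensor.
Variables (E E' F F' : rep k G) (al : rmor E E') (be : rmor F F').
Fact rmor_tensor_nat x y (g : ghom x y) :
  (tmap (al y) (be y) \o act (rep_tensor E F) g)%VF =
  (act (rep_tensor E' F') g \o tmap (al x) (be x))%VF.
Proof. by rewrite /= -!tmap_comp !mor_nat. Qed.
Definition rmor_tensor : rmor (rep_tensor E F) (rep_tensor E' F') :=
  @Rmor _ _ (rep_tensor E F) (rep_tensor E' F')
    (fun x => tmap (al x) (be x)) rmor_tensor_nat.
Lemma rmor_tensor_sect p q :
  sect_map rmor_tensor (sect_tensor p q) =
  sect_tensor (sect_map al p) (sect_map be q).
Proof. by apply: sectP => x; apply: tmap_pure. Qed.
Lemma rmor_tensor_dsect f g :
  dsect_map rmor_tensor (dsect_tensor f g) =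
  dsect_tensor (dsect_map al f) (dsect_map be g).
Proof.
apply: dsect_ext => x T; rewrite dval_map !dval_tensor dval_map /= tmapE.
congr (dval g x (be x (T _))).
by apply/lfunP => v; rewrite comp_lfunE dval_map.
Qed.
End RmorTensor.

Lemma sect_map_id E p : sect_map (rmor_id E) p = p.
Proof. by apply: sectP => x; apply: id_lfunE. Qed.
Lemma dsect_map_id E f : dsect_map (rmor_id E) f = f.
Proof. by apply: dsect_ext => x v; rewrite dval_map /= id_lfunE. Qed.

Definition gen_mul (u v : coend_gen k G) : R :=
  cls (dsect_tensor (gen_dsect u) (gen_dsect v))
      (sect_tensor (gen_sect u) (gen_sect v)).

Definition rmul (x y : R) : R := ext (fun u => ext (gen_mul u) y) x.

Lemma dsect_tensorDl E F (f f' : dsect E) (g : dsect F) :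
  dsect_tensor (dsectD f f') g = dsectD (dsect_tensor f g) (dsect_tensor f' g).
Proof.
apply: dsect_ext => x T; rewrite dvalD !dval_tensor -linearD -linearD.
congr (dval g x (T _)).
by apply/lfunP => w; rewrite add_lfunE dvalD.
Qed.

Lemma dsect_tensorDr E F (f : dsect E) (g g' : dsect F) :
  dsect_tensor f (dsectD g g') = dsectD (dsect_tensor f g) (dsect_tensor f g').
Proof. by apply: dsect_ext => x T; rewrite dvalD !dval_tensor dvalD. Qed.

Lemma sect_tensorDl E F (p p' : sect E) (q : sect F) :
  sect_tensor (p + p') q = sect_tensor p q + sect_tensor p' q.
Proof.
apply: sectP => x; apply/lfunP => w.
rewrite [RHS]add_lfunE !pureE -scalerDl; congr (_ *: _).
by rewrite -[LHS]/(w (p x + p' x)) linearD.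
Qed.

Lemma sect_tensorDr E F (p : sect E) (q q' : sect F) :
  sect_tensor p (q + q') = sect_tensor p q + sect_tensor p q'.
Proof.
apply: sectP => x; apply/lfunP => w.
by rewrite [RHS]add_lfunE !pureE -scalerDr.
Qed.

Lemma gen_mul_dinatl E F (al : rmor E F) (f : dsect F) p v :
  gen_mul (CoendGen f (sect_map al p)) v = gen_mul (CoendGen (dsect_map al f) p) v.
Proof.
rewrite /gen_mul /= -{1}[gen_sect v]sect_map_id -rmor_tensor_sect cls_dinat.
by rewrite rmor_tensor_dsect dsect_map_id.
Qed.

Lemma gen_mul_dinatr u E F (al : rmor E F) (f : dsect F) p :
  gen_mul u (CoendGen f (sect_map al p)) = gen_mul u (CoendGen (dsect_map al f) p).
Proof.
rewrite /gen_mul /= -{1}[gen_sect u]sect_map_id -rmor_tensor_sect cls_dinat.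
by rewrite rmor_tensor_dsect dsect_map_id.
Qed.

Lemma gen_mul_respects u : respects (@coend_rel k G) (gen_mul u).
Proof.
apply: coend_respects => [E g g' p|E g p p'|]; last exact: gen_mul_dinatr.
- by rewrite /gen_mul dsect_tensorDr clsDl.
- by rewrite /gen_mul sect_tensorDr clsDr.
Qed.

Lemma agD_additive (A C : abgroup) (f g : A -> C) :
  additive_map f -> additive_map g -> additive_map (fun x => agD (f x) (g x)).
Proof. by move=> fD gD x y; rewrite fD gD agACA. Qed.

Lemma rmul_respects (y : R) : respects (@coend_rel k G) (fun u => ext (gen_mul u) y).
Proof.
have hD u := extD (@gen_mul_respects u); have hE u := extE (@gen_mul_respects u).
apply: coend_respects => [E g g' p|E g p p'|E F al g p]; move: y;
  apply: additive_ext_eq; rewrite /=; try exact: hD;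
  try by apply: agD_additive; apply: hD.
- by move=> v; rewrite !hE /gen_mul dsect_tensorDl clsDl.
- by move=> v; rewrite !hE /gen_mul sect_tensorDl clsDr.
- by move=> v; rewrite !hE gen_mul_dinatl.
Qed.

Lemma rmul_cls E F (f : dsect E) p (g : dsect F) q :
  rmul (cls f p) (cls g q) = cls (dsect_tensor f g) (sect_tensor p q).
Proof.
by rewrite /rmul (extE (@rmul_respects _)) (extE (@gen_mul_respects _)).
Qed.

Lemma rmulDl y : additive_map (rmul^~ y).
Proof. exact: extD (@rmul_respects y). Qed.

Lemma rmulDr x : additive_map (rmul x).
Proof.
move=> y z; move: x; apply: additive_ext_eq => [|| u].
- exact: rmulDl.
- by apply: agD_additive; apply: rmulDl.
by rewrite /rmul !(extE (@rmul_respects _)) (extD (@gen_mul_respects u)).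
Qed.

(* A function [a] on the objects, seen in [Gamma(I)^*] and in [Gamma(I)]. *)
Definition unit_dsect a : dsect (rep_unit k G) :=
  dsect_of (fun x => a x *: \1%VF : rep_dual (rep_unit k G) x).
Definition unit_sect a : sect (rep_unit k G) := a.

Definition rone : R := cls (unit_dsect 1) (unit_sect 1).
Definition rs a : R := cls (unit_dsect 1) (unit_sect a).
Definition rt a : R := cls (unit_dsect a) (unit_sect 1).

Lemma dval_unit a x : dval (unit_dsect a) x = a x *: \1%VF.
Proof. by rewrite dsect_ofK. Qed.

Section Unitors.
Variable E : rep k G.

Section LeftUnitor.
Variables (x : ob G).
Definition unitl_fun (T : rep_tensor (rep_unit k G) E x) : E x := T \1%VF.
Fact unitl_is_linear : linear unitl_fun.
Proof. by move=> c S T; rewrite /unitl_fun add_lfunE scale_lfunE. Qed.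
HB.instance Definition _ := GRing.isLinear.Build k
  (rep_tensor (rep_unit k G) E x) (E x) _ unitl_fun unitl_is_linear.
End LeftUnitor.

Fact unitl_nat x y (g : ghom x y) :
  (linfun (@unitl_fun y) \o act (rep_tensor (rep_unit k G) E) g)%VF =
  (act E g \o linfun (@unitl_fun x))%VF.
Proof.
apply/lfunP => T; rewrite !comp_lfunE [LHS]lfunE [X in _ = act E g X]lfunE /=.
by rewrite /unitl_fun tmapE comp_lfun1r.
Qed.
Definition unitl : rmor (rep_tensor (rep_unit k G) E) E :=
  Rmor unitl_nat.

Section RightUnitor.
Variables (x : ob G).
Definition unitr_fun (v : E x) : rep_tensor E (rep_unit k G) x :=
  pure v (1 : k^o).
Fact unitr_is_linear : linear unitr_fun.
Proof.
move=> c v w; apply/lfunP => f.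
rewrite add_lfunE scale_lfunE !pureE linearP scalerDl.
by congr (_ + _); rewrite -scalerA.
Qed.
HB.instance Definition _ := GRing.isLinear.Build k
  (E x) (rep_tensor E (rep_unit k G) x) _ unitr_fun unitr_is_linear.
End RightUnitor.

Fact unitr_nat x y (g : ghom x y) :
  (linfun (@unitr_fun y) \o act E g)%VF =
  (act (rep_tensor E (rep_unit k G)) g \o linfun (@unitr_fun x))%VF.
Proof.
apply/lfunP => v; rewrite !comp_lfunE [LHS]lfunE [X in _ = _ X]lfunE /=.
by rewrite /unitr_fun tmap_pure id_lfunE.
Qed.
Definition unitr : rmor E (rep_tensor E (rep_unit k G)) := Rmor unitr_nat.

Lemma rmul_rt a (f : dsect E) p : rmul (rt a) (cls f p) = cls (dsectZ a f) p.
Proof.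
rewrite rmul_cls -[in RHS](_ : sect_map unitl (sect_tensor (unit_sect 1) p) = p).
  rewrite cls_dinat; congr cls; apply: dsect_ext => x T.
  rewrite dval_tensor dval_map dvalZ /= dval_unit !linearZ /=.
  by congr (a x * dval f x _); rewrite lfunE.
apply: sectP => x; rewrite /sect_map /= lfunE /= /unitl_fun pureE id_lfunE.
exact: scale1r.
Qed.

Lemma rmul_rs a (f : dsect E) p : rmul (cls f p) (rs a) = cls f (a *: p).
Proof.
rewrite rmul_cls.
have -> : sect_tensor p (unit_sect a) = sect_map unitr (a *: p).
  apply: sectP => x; rewrite /sect_map /= lfunE /=; apply/lfunP => g.
  rewrite !pureE [in RHS]linearZ /=.
  by rewrite -[LHS]/((g (p x) : k) * a x) -[RHS]/((a x * (g (p x) : k)) * 1)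
     mulr1 mulrC.
rewrite cls_dinat; congr cls; apply: dsect_ext => x v.
rewrite dval_map dval_tensor /= lfunE /= /unitr_fun pureE dval_unit.
by rewrite scale_lfunE id_lfunE scale1r; apply: mulr1.
Qed.
End Unitors.

Lemma dsectZ1 E (f : dsect E) : dsectZ 1 f = f.
Proof. by apply: dsect_ext => x v; rewrite dvalZ; apply: mul1r. Qed.
Lemma dsectZDl E a b (f : dsect E) :
  dsectZ (a + b) f = dsectD (dsectZ a f) (dsectZ b f).
Proof. by apply: dsect_ext => x v; rewrite dvalD !dvalZ; apply: mulrDl. Qed.
Lemma dsectZ_unit a b : dsectZ a (unit_dsect b) = unit_dsect (a * b).
Proof.
by apply: dsect_ext => x v; rewrite dvalZ !dval_unit !scale_lfunE id_lfunE; apply: mulrA.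
Qed.

Lemma cls_scale (c : k) E (f : dsect E) p :
  cls (dsectZ (cst c) f) p = cls f ((cst c : B) *: p).
Proof.
have -> : (cst c : B) *: p = sect_map (rmor_scale c E) p.
  by apply: sectP => x; rewrite /sect_map /= scale_lfunE id_lfunE.
rewrite cls_dinat; congr cls; apply: dsect_ext => x v.
by rewrite dvalZ dval_map /= scale_lfunE id_lfunE linearZ.
Qed.

Lemma rtD a b : rt (a + b) = agD (rt a) (rt b).
Proof.
rewrite -clsDl; congr cls; rewrite -[a + b]mulr1 -dsectZ_unit dsectZDl.
by rewrite !dsectZ_unit !mulr1.
Qed.
Lemma rsD a b : rs (a + b) = agD (rs a) (rs b).
Proof. exact: clsDr. Qed.
Lemma rt1 : rt 1 = rone. Proof. by []. Qed.
Lemma rs1 : rs 1 = rone. Proof. by []. Qed.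

Lemma rmul_rt_rs a b : rmul (rt a) (rs b) = cls (unit_dsect a) (unit_sect b).
Proof. by rewrite rmul_rt dsectZ_unit mulr1. Qed.

(* [B (x)_k B] and the structure maps of the [B (x)_k B]-algebras [R] and
   [arrow G -> k]; see [BB_repfunE] and [BB_totalE]. *)
Definition BB : abgroup :=
  @tensor k (ab_of B) (ab_of B) (fun a c => a * cst c) (fun c b => cst c * b).

Definition BB_repfun : BB -> R := ext (fun u : B * B => rmul (rt u.1) (rs u.2)).

Definition BB_total : BB -> (arrow G -> k) :=
  ext (A := ab_of (arrow G -> k))
    (fun u : B * B => fun g => u.1 (tgt g) * u.2 (src g)).

Fact BB_repfun_respects : respects
  (@tensor_rel k (ab_of B) (ab_of B) (fun a c => a * cst c) (fun c b => cst c * b))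
  (fun u : B * B => rmul (rt u.1) (rs u.2)).
Proof.
apply: (@tensor_respects _ (ab_of B) (ab_of B) _ _ R) => [n m m'|m n n'|m c n] /=.
- by rewrite -[RHS]rmulDl -rtD.
- by rewrite -[RHS]rmulDr -rsD.
- by rewrite !rmul_rt_rs [m * _]mulrC -dsectZ_unit cls_scale.
Qed.

Lemma BB_repfunE a b :
  BB_repfun (tens _ _ (a : ab_of B) (b : ab_of B)) = rmul (rt a) (rs b).
Proof. exact: (extE BB_repfun_respects). Qed.

Lemma BB_repfunD : additive_map BB_repfun.
Proof. exact: (extD BB_repfun_respects). Qed.

Fact BB_total_respects : respects
  (@tensor_rel k (ab_of B) (ab_of B) (fun a c => a * cst c) (fun c b => cst c * b))
  (fun u : B * B => (fun g => u.1 (tgt g) * u.2 (src g)) : ab_of (arrow G -> k)).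
Proof.
apply: (@tensor_respects _ (ab_of B) (ab_of B) _ _ (ab_of (arrow G -> k)))
  => [n m m'|m n n'|m c n] /=; apply: funext => g /=.
- exact: mulrDl.
- exact: mulrDr.
- by rewrite -[LHS]/(m (tgt g) * c * n (src g)) -mulrA.
Qed.

Lemma BB_totalE a b g :
  BB_total (tens _ _ (a : ab_of B) (b : ab_of B)) g = a (tgt g) * b (src g).
Proof. by rewrite /BB_total (extE BB_total_respects). Qed.

Lemma BB_totalD (u v : BB) : BB_total (agD u v) = BB_total u + BB_total v.
Proof. exact: (extD BB_total_respects). Qed.

Definition gen_eps (u : coend_gen k G) : B :=
  fun x => dval (gen_dsect u) x (gen_sect u x).
Definition reps : R -> B := ext (A := ab_of B) gen_eps.

Fact gen_eps_respects : respects (@coend_rel k G) (gen_eps : _ -> ab_of B).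
Proof.
apply: coend_respects => [E g g' p|E g p p'|E F al g p]; apply: funext => x.
- exact: dvalD.
- exact: (linearD (dval g x)).
- by rewrite /gen_eps /= dval_map.
Qed.

Lemma reps_cls E (f : dsect E) p : reps (cls f p) = fun x => dval f x (p x).
Proof. exact: (extE gen_eps_respects). Qed.
Lemma repsD x y : reps (agD x y) = reps x + reps y.
Proof. exact: (extD gen_eps_respects). Qed.

(* The image of [p] under [E = E^**], as an element of [Gamma(E^* )^*]. *)
Definition bidual E (p : sect E) : dsect (rep_dual E) :=
  dsect_of (fun x => evalV (p x) : rep_dual (rep_dual E) x).

Definition gen_antipode (u : coend_gen k G) : R :=
  cls (bidual (gen_sect u)) (dval (gen_dsect u)).
Definition antipode : R -> R := ext gen_antipode.

Lemma dval_bidual E (p : sect E) x (f : dualV (E x)) :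
  dval (bidual p) x f = f (p x).
Proof. by rewrite dsect_ofK evalVE. Qed.

Section RmorDual.
Variables (E F : rep k G) (al : rmor E F).
Fact rmor_dual_nat x y (g : ghom x y) :
  (transpose (al y) \o act (rep_dual F) g)%VF =
  (act (rep_dual E) g \o transpose (al x))%VF.
Proof.
apply/lfunP => f; rewrite !comp_lfunE /= !precompE -!comp_lfunA.
by rewrite mor_nat.
Qed.
Definition rmor_dual : rmor (rep_dual F) (rep_dual E) :=
  @Rmor _ _ (rep_dual F) (rep_dual E) (fun x => transpose (al x)) rmor_dual_nat.
End RmorDual.

Fact gen_antipode_respects : respects (@coend_rel k G) gen_antipode.
Proof.
apply: coend_respects => [E g g' p|E g p p'|E F al g p].
- rewrite -clsDr; congr cls; apply: sectP => x; apply/lfunP => v.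
  by rewrite [RHS]add_lfunE dvalD.
- rewrite -clsDl; congr cls; apply: dsect_ext => x f.
  by rewrite dvalD !dval_bidual linearD.
- rewrite /gen_antipode /=.
  have -> : dval (dsect_map al g) = sect_map (rmor_dual al) (dval g).
    apply: sectP => x; apply/lfunP => v.
    by rewrite dval_map /sect_map /= precompE comp_lfunE.
  rewrite cls_dinat; congr cls; apply: dsect_ext => x f.
  by rewrite dval_map !dval_bidual /= precompE comp_lfunE.
Qed.

Lemma antipode_cls E (f : dsect E) p : antipode (cls f p) = cls (bidual p) (dval f).
Proof. exact: (extE gen_antipode_respects). Qed.
Lemma antipodeD : additive_map antipode.
Proof. exact: (extD gen_antipode_respects). Qed.

(* [R (x)_B R], for the bimodule structure given by [t] on the left and [s] on
   the right. *)
Definition RR : abgroup :=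
  @tensor B R R (fun x b => rmul x (rs b)) (fun b y => rmul (rt b) y).
Definition rtens (x y : R) : RR := tens _ _ x y.

Lemma rtensDl x y z : rtens (agD x y) z = agD (rtens x z) (rtens y z).
Proof. exact: tensDl. Qed.
Lemma rtensDr x y z : rtens x (agD y z) = agD (rtens x y) (rtens x z).
Proof. exact: tensDr. Qed.
Lemma rtens_cls E F (f : dsect E) p (g : dsect F) q b :
  rtens (cls f (b *: p)) (cls g q) = rtens (cls f p) (cls (dsectZ b g) q).
Proof. by rewrite -rmul_rs -rmul_rt; apply: tensZ. Qed.

Definition rtens_sum (l : seq (R * R)) : RR := sum_tens _ _ l.

(* The pairs in [l] are the [(s_i, s_i^* )]. *)
Definition is_dual_basis E (l : seq (sect E * dsect E)) :=
  forall p : sect E, p = \sum_(u <- l) (u.2 p : B) *: u.1.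

Lemma dual_basis_exists E : exists l, @is_dual_basis E l.
Proof.
have [V fV] := fib_iso E.
have h x : exists fg : 'Hom(E x, V) * 'Hom(V, E x), (fg.2 \o fg.1)%VF = \1%VF.
  by have [f /lfun_bij_inv [g gf _]] := fV x; exists (f, g).
pose fg x := sval (cid (h x)).
have fgK x : ((fg x).2 \o (fg x).1)%VF = \1%VF by rewrite /fg; case: cid.
exists [seq ((fun x => (fg x).2 (bas i)) : sect E,
             dsect_of (fun x => (cobas i \o (fg x).1)%VF : rep_dual E x))
       | i <- enum 'I_(\dim {:V})] => p.
rewrite big_map big_enum /=; apply: sectP => x; rewrite sect_sum.
rewrite -[LHS]id_lfunE -fgK comp_lfunE [(fg x).1 (p x)]basE linear_sum.
apply: eq_bigr => i _; rewrite linearZ; congr (_ *: _).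
by rewrite -dvalE dval_of comp_lfunE.
Qed.

Definition dual_basis E : seq (sect E * dsect E) :=
  sval (cid (dual_basis_exists E)).

Lemma dual_basisP E : is_dual_basis (dual_basis E).
Proof. by rewrite /dual_basis; case: cid. Qed.

Definition gen_Delta (u : coend_gen k G) : RR :=
  rtens_sum [seq (cls (gen_dsect u) v.1, cls v.2 (gen_sect u))
            | v <- dual_basis (gen_rep u)].

(* [Delta_cls] shows that the choice of dual bases is immaterial. *)
Definition Delta : R -> RR := ext gen_Delta.

Lemma cls_sumr E (f : dsect E) I (l : seq I) (p : I -> sect E) :
  cls f (\sum_(i <- l) p i) = \big[@agD R/ag0]_(i <- l) cls f (p i).
Proof.
elim: l => [|i l IH]; last by rewrite !big_cons clsDr IH.
by rewrite !big_nil; apply: ag_idem; rewrite -clsDr addr0.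
Qed.

Lemma cls_suml E I (l : seq I) (f : I -> dsect E) (g : dsect E) p :
    (forall q, g q = \sum_(i <- l) f i q) ->
  cls g p = \big[@agD R/ag0]_(i <- l) cls (f i) p.
Proof.
elim: l g => [|i l IH] g gE.
  rewrite big_nil; apply: ag_idem; rewrite -clsDl; congr cls.
  by apply: dsectP => q; rewrite /= gE big_nil; apply: addr0.
pose h : dsect E := dsectD g (dsectZ (-1) (f i)).
have hE q : h q = \sum_(j <- l) f j q.
  rewrite -[LHS]/(g q + -1 * (f i q : B)) gE big_cons mulN1r.
  by rewrite addrAC subrr add0r.
rewrite big_cons -(IH h hE) -clsDl; congr cls; apply: dsectP => q.
by rewrite -[RHS]/((f i q : B) + h q) hE gE big_cons.
Qed.

Lemma dual_basis_change E F (al : rmor E F) l m (f : dsect F) p :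
    is_dual_basis l -> is_dual_basis m ->
  rtens_sum [seq (cls (dsect_map al f) v.1, cls v.2 p) | v <- l] =
  rtens_sum [seq (cls f w.1, cls w.2 (sect_map al p)) | w <- m].
Proof.
move=> lP mP; rewrite /rtens_sum /sum_tens !big_map.
pose c (v : sect E * dsect E) (w : sect F * dsect F) : B :=
  w.2 (sect_map al v.1).
transitivity (\big[@agD RR/ag0]_(v <- l) \big[@agD RR/ag0]_(w <- m)
   rtens (cls f w.1) (cls (dsectZ (c v w) v.2) p)).
  apply: eq_bigr => v _; rewrite -cls_dinat [sect_map al v.1](mP) cls_sumr.
  rewrite -/(rtens _ _) (addm_sum (f := fun x => rtens x (cls v.2 p))) => [|x y]; last exact: rtensDl.
  by apply: eq_bigr => w _; rewrite -rtens_cls.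
rewrite exchange_big /=; apply: eq_bigr => w _.
rewrite -(addm_sum (f := rtens (cls f w.1))) => [|x y]; last exact: rtensDr.
congr rtens; rewrite cls_dinat; symmetry; apply: cls_suml => q.
rewrite /= [in LHS](lP q) !linear_sum; apply: eq_bigr => v _.
by rewrite !linearZ [RHS]mulrC.
Qed.

Fact gen_Delta_respects : respects (@coend_rel k G) gen_Delta.
Proof.
apply: coend_respects => [E g g' p|E g p p'|E F al g p].
- rewrite /gen_Delta /rtens_sum /sum_tens !big_map -big_split /=.
  by apply: eq_bigr => v _; rewrite clsDl; apply: rtensDl.
- rewrite /gen_Delta /rtens_sum /sum_tens !big_map -big_split /=.
  by apply: eq_bigr => v _; rewrite clsDr; apply: rtensDr.
- by symmetry; apply: dual_basis_change; apply: dual_basisP.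
Qed.

Lemma Delta_cls E (l : seq (sect E * dsect E)) (f : dsect E) p :
    is_dual_basis l ->
  Delta (cls f p) = rtens_sum [seq (cls f v.1, cls v.2 p) | v <- l].
Proof.
move=> lP; rewrite /Delta (extE gen_Delta_respects) /gen_Delta /=.
rewrite -{1}[f](dsect_map_id (E := E)) -[in RHS](sect_map_id p).
by apply: dual_basis_change => //; apply: dual_basisP.
Qed.

Lemma DeltaD : additive_map Delta.
Proof. exact: (extD gen_Delta_respects). Qed.

Definition gen_zeta (u : coend_gen k G) : arrow G -> k :=
  fun g => dval (gen_dsect u) (tgt g)
             (act (gen_rep u) (arr g) (gen_sect u (src g))).
Definition zeta : R -> (arrow G -> k) := ext (A := ab_of (arrow G -> k)) gen_zeta.

Definition iota_star (h : arrow G -> k) : B := fun x => h (arrow_id x).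

End HopfAlgebroid.

Arguments BB : clear implicits.
Arguments rone : clear implicits.

(* Main.v *)
Require Import Defs.
From HB Require Import structures.
From mathcomp Require Import all_boot all_order all_algebra.
From mathcomp Require Import boolp classical_sets functions.

Set Implicit Arguments.
Unset Strict Implicit.
Unset Printing Implicit Defensive.
Import GRing.Theory.
Local Open Scope ring_scope.

(* Everything but injectivity is checked on the generators of the coend.  For
   injectivity, direct sums reduce an element of the kernel to a single class of
   [f (x) p], with [f] zero on all vectors [act g (p x)].  The spans [U x] of
   these vectors form a subrepresentation of [E], but the rank of [U] may vary
   from one component of [G] to another; adding the complementary quotient,
   [U (+) E/U] has constant rank and maps to [E] with image [U].  As [p] lifts
   along this morphism and [f] vanishes after composition with it, dinaturality
   gives [f (x) p = 0 (x) p = 0]. *)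

(** * Smallest subspace containing a set of vectors *)

Section SpanOfSet.
Variables (k : fieldType) (V : vectType k) (S : V -> Prop).

(** Take [U] of least dimension among the subspaces containing [S]: if [W] contains [S], so does the
    intersection of [U] and [W], which therefore cannot be smaller than [U]. *)
Lemma min_subspace_exists : exists U : {vspace V},
  (forall v, S v -> v \in U) /\
  (forall W : {vspace V}, (forall v, S v -> v \in W) -> (U <= W)%VS).
Proof.
pose P n := `[< exists2 U : {vspace V}, \dim U = n & forall v, S v -> v \in U >].
have exP : exists n, P n.
  by exists (\dim {:V}); apply/asboolP; exists fullv => // v _; apply: memvf.
case: (ex_minnP exP) => _ /asboolP[U <- SU] Umin.
exists U; split=> // W SW; apply/capv_idPl/eqP.
rewrite eqEdim capvSl; apply: Umin; apply/asboolP; exists (U :&: W)%VS => // v Sv.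
by rewrite memv_cap SU ?SW.
Qed.

Definition span_set : {vspace V} := sval (cid min_subspace_exists).

Lemma mem_span_set v : S v -> v \in span_set.
Proof. by have [SU _] := svalP (cid min_subspace_exists); apply: SU. Qed.

Lemma span_set_min (W : {vspace V}) :
  (forall v, S v -> v \in W) -> (span_set <= W)%VS.
Proof. by have [_ minU] := svalP (cid min_subspace_exists); apply: minU. Qed.

End SpanOfSet.

(** * Splitting off an invariant family of subspaces *)

Section SplitRep.
Variables (k : fieldType) (G : groupoid) (E : rep k G).
Variable U : forall x, {vspace E x}.
Hypothesis U_act : forall x y (g : ghom x y) v, v \in U x -> act E g v \in U y.

(** The block diagonal part of [act E g] for the splitting of each fiber into [U] and the kernel of
    [projv]; it commutes with these projections, which [act E g] need not do. *)
Definition split_act x y (g : ghom x y) : 'Hom(E x, E y) :=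
  ((act E g \o projv (U x)) +
   ((\1 - projv (U y)) \o act E g \o (\1 - projv (U x))))%VF.

Lemma split_actE x y (g : ghom x y) v :
  split_act g v = act E g (projv (U x) v)
    + (act E g (v - projv (U x) v) - projv (U y) (act E g (v - projv (U x) v))).
Proof. by rewrite add_lfunE !comp_lfunE !add_lfunE !opp_lfunE !id_lfunE. Qed.

(** The first summand of [split_act] lies in [U] by [U_act]; the projection kills the second. *)
Lemma projv_split_act x y (g : ghom x y) v :
  projv (U y) (split_act g v) = act E g (projv (U x) v).
Proof.
rewrite split_actE linearD linearB /= [projv _ (projv _ _)]projv_id ?memv_proj //.
by rewrite subrr addr0 projv_id // U_act ?memv_proj.
Qed.

Fact split_act1 x : split_act (gid x) = \1%VF.
Proof.
apply/lfunP => v; rewrite split_actE act1 !id_lfunE linearB /=.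
by rewrite [projv _ (projv _ _)]projv_id ?memv_proj // subrr subr0 addrC subrK.
Qed.

Fact split_actM x y z (g : ghom y z) (f : ghom x y) :
  split_act (gcmp g f) = (split_act g \o split_act f)%VF.
Proof.
apply/lfunP => v; rewrite comp_lfunE [RHS]split_actE projv_split_act.
rewrite [LHS]split_actE actM !comp_lfunE; congr (_ + _).
rewrite [split_act f v]split_actE [_ + _ - _]addrC addKr.
set w := act E f _; rewrite [act E g (_ - _)]linearB [projv _ (_ - _)]linearB /=.
(* [act E g] sends the [U]-part of [w] into [U], where [projv] is the identity, so this part
   cancels. *)
rewrite [projv _ (act E g (projv _ _))]projv_id ?U_act ?memv_proj //.
by rewrite opprB addrA subrK.
Qed.

(* [U (+) E/U], carried by the fibers of [E] through the projections [projv]. *)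
Definition split_rep : rep k G := Rep (fib_iso E) split_act1 split_actM.

Fact split_proj_nat x y (g : ghom x y) :
  (projv (U y) \o act split_rep g)%VF = (act E g \o projv (U x))%VF.
Proof. by apply/lfunP => v; rewrite !comp_lfunE projv_split_act. Qed.
Definition split_proj : rmor split_rep E :=
  @Rmor _ _ split_rep E (fun x => projv (U x)) split_proj_nat.

End SplitRep.

(** * Block maps between products of vector spaces *)

Section ProductMaps.
Variable k : fieldType.

Section Blocks.
Variables (V V' W W' : vectType k).
Definition prod_lfun_fun (a : 'Hom(V, V')) (b : 'Hom(W, W'))
  (u : (V * W)%type) : (V' * W')%type := (a u.1, b u.2).
Fact prod_lfun_is_linear a b : linear (prod_lfun_fun a b).
Proof. by move=> c u v; rewrite /prod_lfun_fun !linearP. Qed.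
HB.instance Definition _ a b := GRing.isLinear.Build k
  (V * W)%type (V' * W')%type _ (prod_lfun_fun a b) (prod_lfun_is_linear a b).
Definition prod_lfun a b : 'Hom((V * W)%type, (V' * W')%type) :=
  linfun (prod_lfun_fun a b).
Lemma prod_lfunE a b u : prod_lfun a b u = (a u.1, b u.2).
Proof. by rewrite lfunE. Qed.

Definition inl_fun (v : V) : (V * W)%type := (v, 0).
Definition inr_fun (w : W) : (V * W)%type := (0, w).
Fact inl_is_linear : linear inl_fun.
Proof. by move=> c u v; rewrite /inl_fun; congr pair; rewrite /= scaler0 addr0. Qed.
Fact inr_is_linear : linear inr_fun.
Proof. by move=> c u v; rewrite /inr_fun; congr pair; rewrite /= scaler0 addr0. Qed.
HB.instance Definition _ := GRing.isLinear.Build k V (V * W)%type _ inl_fun inl_is_linear.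
HB.instance Definition _ := GRing.isLinear.Build k W (V * W)%type _ inr_fun inr_is_linear.

Definition copair_fun (a : 'Hom(V, V')) (b : 'Hom(W, V')) (u : (V * W)%type) : V' :=
  a u.1 + b u.2.
Fact copair_is_linear a b : linear (copair_fun a b).
Proof. by move=> c u v; rewrite /copair_fun /= !linearP scalerDr addrACA. Qed.
HB.instance Definition _ a b := GRing.isLinear.Build k
  (V * W)%type V' _ (copair_fun a b) (copair_is_linear a b).
Definition copair a b : 'Hom((V * W)%type, V') := linfun (copair_fun a b).
Lemma copairE a b u : copair a b u = a u.1 + b u.2.
Proof. by rewrite lfunE. Qed.
End Blocks.

Lemma prod_lfun1 (V W : vectType k) :
  prod_lfun \1%VF \1%VF = \1%VF :> 'Hom((V * W)%type : vectType k, _).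
Proof. by apply/lfunP => -[u v]; rewrite prod_lfunE !id_lfunE. Qed.

Lemma prod_lfun_comp (V V' V'' W W' W'' : vectType k)
    (a : 'Hom(V, V')) (a' : 'Hom(V', V''))
    (b : 'Hom(W, W')) (b' : 'Hom(W', W'')) :
  prod_lfun (a' \o a)%VF (b' \o b)%VF = (prod_lfun a' b' \o prod_lfun a b)%VF.
Proof. by apply/lfunP => u; rewrite comp_lfunE !prod_lfunE !comp_lfunE. Qed.

End ProductMaps.

(** * Direct sums of representations *)

Section DirectSum.
Variables (k : fieldType) (G : groupoid) (E F : rep k G).

Fact sum_iso : exists V : vectType k, forall x,
  exists f : 'Hom((E x * F x)%type : vectType k, V), bijective f.
Proof.
have [V fV] := fib_iso E; have [W gW] := fib_iso F.
exists (V * W)%type => x.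
have [f /lfun_bij_inv [f' ff1 ff2]] := fV x.
have [g /lfun_bij_inv [g' gg1 gg2]] := gW x.
exists (prod_lfun f g); apply: (@lfun_inv_bij _ _ _ _ (prod_lfun f' g')).
  by rewrite -prod_lfun_comp ff1 gg1 prod_lfun1.
by rewrite -prod_lfun_comp ff2 gg2 prod_lfun1.
Qed.
Fact sum_act1 x : prod_lfun (act E (gid x)) (act F (gid x)) = \1%VF.
Proof. by rewrite !act1 prod_lfun1. Qed.
Fact sum_actM x y z (g : ghom y z) (f : ghom x y) :
  prod_lfun (act E (gcmp g f)) (act F (gcmp g f)) =
  (prod_lfun (act E g) (act F g) \o prod_lfun (act E f) (act F f))%VF.
Proof. by rewrite !actM prod_lfun_comp. Qed.
Definition rep_sum : rep k G :=
  @Rep k G (fun x => (E x * F x)%type : vectType k)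
    (fun x y g => prod_lfun (act E g) (act F g)) sum_iso sum_act1 sum_actM.

Fact inl_nat x y (g : ghom x y) :
  (linfun (@inl_fun _ (E y) (F y)) \o act E g)%VF =
  (act rep_sum g \o linfun (@inl_fun _ (E x) (F x)))%VF.
Proof.
apply/lfunP => v; rewrite !comp_lfunE /= prod_lfunE !(lfunE (@inl_fun _ _ _)) /=.
by rewrite linear0.
Qed.
Fact inr_nat x y (g : ghom x y) :
  (linfun (@inr_fun _ (E y) (F y)) \o act F g)%VF =
  (act rep_sum g \o linfun (@inr_fun _ (E x) (F x)))%VF.
Proof.
apply/lfunP => v; rewrite !comp_lfunE /= prod_lfunE !(lfunE (@inr_fun _ _ _)) /=.
by rewrite linear0.
Qed.
Definition rmor_inl : rmor E rep_sum :=
  @Rmor _ _ E rep_sum (fun x => linfun (@inl_fun _ (E x) (F x))) inl_nat.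
Definition rmor_inr : rmor F rep_sum :=
  @Rmor _ _ F rep_sum (fun x => linfun (@inr_fun _ (E x) (F x))) inr_nat.

(** The functional [h] restricts to [f] and [g] along the two injections, so dinaturality brings the
    two summands of its class back to [E] and [F]. *)
Lemma cls_add (f : dsect E) (p : sect E) (g : dsect F) (q : sect F) :
  exists (h : dsect rep_sum) (r : sect rep_sum),
    agD (cls f p) (cls g q) = cls h r.
Proof.
pose h : dsect rep_sum := dsect_of (fun x =>
  copair (dval f x : 'Hom(E x, k^o)) (dval g x : 'Hom(F x, k^o)) : rep_dual rep_sum x).
exists h, (sect_map rmor_inl p + sect_map rmor_inr q).
rewrite clsDr !cls_dinat; congr agD; congr cls; apply: dsect_ext => x v;
  rewrite dval_map dval_of copairE /=.
  by rewrite (lfunE (@inl_fun _ _ _)) /= linear0 addr0.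
by rewrite (lfunE (@inr_fun _ _ _)) /= linear0 add0r.
Qed.

End DirectSum.

(** * Compatibility of [zeta] with the algebra structures *)

Section Zeta.
Variables (k : fieldType) (G : groupoid).
Local Notation R := (repfun k G).
Implicit Types (E F : rep k G) (a b : ob G -> k).

Fact gen_zeta_respects :
  respects (@coend_rel k G) (@gen_zeta k G : _ -> ab_of (arrow G -> k)).
Proof.
apply: coend_respects => [E h h' p|E h p p'|E F al h p]; apply: funext => g.
- exact: dvalD.
- by rewrite /gen_zeta /= -[act E _ _]/(act E _ (p _ + p' _)) !linearD.
- by rewrite /gen_zeta /= dval_map /sect_map -[act F _ _]comp_lfunE -mor_nat comp_lfunE.
Qed.

Lemma zeta_cls E (f : dsect E) (p : sect E) (g : arrow G) :
  zeta (cls f p) g = dval f (tgt g) (act E (arr g) (p (src g))).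
Proof. by rewrite /zeta (extE gen_zeta_respects). Qed.

Lemma zetaD (F F' : R) : zeta (agD F F') = zeta F + zeta F'.
Proof. exact: (extD gen_zeta_respects). Qed.

Lemma zetaN (F : R) : zeta (agN F) = - zeta F.
Proof. exact: (@addmN _ (ab_of (arrow G -> k)) _ zetaD). Qed.

Lemma zeta_rs a g : zeta (rs a) g = a (src g).
Proof. by rewrite zeta_cls /= dval_unit scale_lfunE !id_lfunE; apply: mul1r. Qed.

Lemma zeta_rt a g : zeta (rt a) g = a (tgt g).
Proof. by rewrite zeta_cls /= dval_unit scale_lfunE !id_lfunE; apply: mulr1. Qed.

Lemma zeta1 : zeta (rone k G) = 1.
Proof. by apply: funext => g; apply: zeta_rs. Qed.

Lemma zetaM (F F' : R) : zeta (rmul F F') = zeta F * zeta F'.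
Proof.
move: F; apply: (@additive_ext_eq _ _ (ab_of (arrow G -> k))).
- by move=> x y; rewrite rmulDl; apply: zetaD.
- by move=> x y; rewrite zetaD; apply: mulrDl.
move=> u; move: F'; apply: (@additive_ext_eq _ _ (ab_of (arrow G -> k))).
- by move=> x y; rewrite rmulDr; apply: zetaD.
- by move=> x y; rewrite zetaD; apply: mulrDr.
case: u => E f p [E' f' p']; apply: funext => g.
rewrite -!/(cls _ _) rmul_cls -[RHS]/(zeta _ g * zeta _ g) !zeta_cls.
by rewrite dval_of [act _ _ _]tmap_pure; apply: tpair_pure.
Qed.

(** With [zetaM], this makes [zeta] linear over [BB]. *)
Lemma zeta_BB (u : BB k G) : zeta (BB_repfun u) = BB_total u.
Proof.
move: u; apply: (@additive_ext_eq _ _ (ab_of (arrow G -> k))).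
- by move=> x y; rewrite BB_repfunD; apply: zetaD.
- exact: BB_totalD.
move=> [a b]; rewrite BB_repfunE; apply: funext => g.
by rewrite BB_totalE zetaM -[LHS]/(zeta _ g * zeta _ g) zeta_rt zeta_rs.
Qed.

(** * Injectivity of [zeta] *)

Lemma cls0l E (p : sect E) (f : dsect E) :
  (forall x v, dval f x v = 0) -> cls f p = ag0.
Proof.
move=> f0; apply: ag_idem; rewrite -clsDl; congr cls; apply: dsect_ext => x v.
by rewrite dvalD f0 addr0.
Qed.

(** Induction on the generation of [R] as a group: zero is the class of a zero functional, signs go
    into the section, and [cls_add] absorbs sums. *)
Lemma repfun_cls (F : R) : exists E (f : dsect E) (p : sect E), F = cls f p.
Proof.
elim/pres_gen_ind: F => [|[E f p]|c [E [f [p ->]]]|c d].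
- exists (rep_unit k G), (unit_dsect 0), (unit_sect 0); symmetry; apply: cls0l.
  by move=> x v; rewrite dval_unit scale0r lfunE.
- by exists E, f, p.
- exists E, f, (- p); apply: (@agDI _ (cls f p)); rewrite agDN -clsDr subrr.
  by symmetry; apply: ag_idem; rewrite -clsDr addr0.
move=> [E [f [p ->]]] [E' [g [q ->]]].
by have [h [r ->]] := cls_add f p g q; exists (rep_sum E E'), h, r.
Qed.

Lemma zeta_cls_eq0 E (f : dsect E) (p : sect E) :
  zeta (cls f p) = 0 -> cls f p = ag0.
Proof.
move=> z0.
pose S x (v : E x) := exists y (g : ghom y x), v = act E g (p y).
pose U x := span_set (S x).
have U_act x y (g : ghom x y) v : v \in U x -> act E g v \in U y.
  (* The preimage of [U y] under [act E g] is a subspace; by minimality of [U x] it suffices that it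
     contains the vectors of [S x]. *)
  rewrite memv_preim; move: v; apply/subvP/span_set_min => _ [z [h ->]].
  rewrite -memv_preim; apply: mem_span_set.
  by exists z, (gcmp g h); rewrite actM comp_lfunE.
have fU x v : v \in U x -> dval f x v = 0.
  (* By minimality again, only vectors of [S x] matter; on them [f] takes values of
     [zeta (cls f p)]. *)
  move=> vU; apply/eqP; rewrite -memv_ker.
  move: v vU; apply/subvP/span_set_min => _ [z [h ->]].
  by rewrite memv_ker; apply/eqP; have := congr1 (@^~ (Arrow h)) z0; rewrite zeta_cls.
(* On the right [p] is read as a section of [split_rep], which has the fibers of [E]; identity
   arrows put [p x] in [U x], so the projection fixes it. *)
have -> : p = sect_map (split_proj U_act) p.
  apply: sectP => x; rewrite /sect_map /= projv_id //.
  by apply: mem_span_set; exists x, (gid x); rewrite act1 id_lfunE.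
rewrite cls_dinat; apply: cls0l => x v.
by rewrite dval_map; apply: fU; apply: memv_proj.
Qed.

Lemma zeta_inj : injective (@zeta k G).
Proof.
move=> F F' e; have [E [f [p d]]] := repfun_cls (agD F (agN F')).
have d0 : agD F (agN F') = ag0.
  by rewrite d; apply: zeta_cls_eq0; rewrite -d zetaD zetaN e subrr.
by apply: (@agDI _ (agN F')); rewrite agND agC.
Qed.

(** * Counit and antipode *)

Lemma zeta_id (F : R) : iota_star (zeta F) = reps F.
Proof.
move: F; apply: (@additive_ext_eq _ _ (ab_of (ob G -> k))).
- by move=> x y; rewrite zetaD.
- exact: repsD.
case=> E f p; rewrite -/(cls f p) reps_cls; apply: funext => x.
by rewrite /iota_star zeta_cls /= act1 id_lfunE.
Qed.

(** The dual representation acts along [g] by precomposition with the action of the inverse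
    arrow. *)
Lemma zeta_antipode (F : R) (g : arrow G) :
  zeta (antipode F) g = zeta F (arrow_inv g).
Proof.
move: F; apply: (@additive_ext_eq _ _ (ab_of k)).
- by move=> x y; rewrite antipodeD zetaD.
- by move=> x y; rewrite zetaD.
case=> E f p; rewrite -/(cls f p) antipode_cls !zeta_cls dval_bidual /=.
by rewrite precompE comp_lfunE.
Qed.

(** * Comultiplication and composition of arrows *)

Section Comultiplication.
Variables (x y z : ob G) (g : ghom y z) (f : ghom x y).

(** Defined on [RR] itself, so that its value at [Delta F] is the same for every way of writing
    [Delta F] as a sum of pure tensors. *)
Definition zeta2 : RR k G -> k :=
  ext (A := ab_of k) (fun u : R * R => zeta u.1 (Arrow g) * zeta u.2 (Arrow f)).

(** Balancing holds because [g] starts where [f] ends: [rs b] at [g] and [rt b] at [f] both give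
    [b y]. *)
Fact zeta2_respects : respects
  (@tensor_rel (ob G -> k) R R (fun x b => rmul x (rs b)) (fun b y => rmul (rt b) y))
  (fun u : R * R => zeta u.1 (Arrow g) * zeta u.2 (Arrow f) : ab_of k).
Proof.
apply: (@tensor_respects _ R R _ _ (ab_of k)) => [n m m'|m n n'|m b n] /=.
- by rewrite zetaD; apply: mulrDl.
- by rewrite zetaD; apply: mulrDr.
rewrite !zetaM -[LHS]/(zeta m _ * zeta (rs b) _ * _).
by rewrite -[RHS]/(_ * (zeta (rt b) _ * zeta n _)) zeta_rs zeta_rt mulrA.
Qed.

Lemma zeta2D : @additive_map (RR k G) (ab_of k) zeta2.
Proof. exact: (extD zeta2_respects). Qed.

Lemma zeta2_sum (l : seq (R * R)) :
  zeta2 (rtens_sum l) = \sum_(u <- l) zeta u.1 (Arrow g) * zeta u.2 (Arrow f).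
Proof.
rewrite /rtens_sum /sum_tens (addm_sum zeta2D); apply: eq_bigr => u _.
exact: (extE zeta2_respects).
Qed.

Lemma zeta2_Delta (F : R) : zeta2 (Delta F) = zeta F (Arrow (gcmp g f)).
Proof.
move: F; apply: (@additive_ext_eq _ _ (ab_of k)).
- by move=> u v; rewrite DeltaD zeta2D.
- by move=> u v; rewrite zetaD.
case=> E h p; rewrite -/(cls h p) (Delta_cls _ _ (@dual_basisP _ _ E)) zeta2_sum big_map.
rewrite zeta_cls /= actM comp_lfunE.
(* A dual basis expands sections, not vectors: the vector is extended by zero away from [y],
   expanded, and read off at [y]. *)
rewrite -[act E f _](at_pointE (x := y)).
rewrite [in RHS](@dual_basisP _ _ _ (at_point (act E f (p x)))) sect_sum !linear_sum.
apply: eq_bigr => u _; rewrite !zeta_cls /= dval_at.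
have -> : forall (c : ob G -> k) (q : sect E), (c *: q) y = c y *: q y by [].
by rewrite !linearZ mulrC -!dval_at.
Qed.

End Comultiplication.
End Zeta.

Theorem proposition2p2 (k : fieldType) (G : groupoid) :
  (forall (E : rep k G) (f : dsect E) (p : sect E) (g : arrow G),
     zeta (cls f p) g = dval f (tgt g) (act E (arr g) (p (src g)))) /\
  (forall F F' : repfun k G, zeta (agD F F') = zeta F + zeta F') /\
  zeta (rone k G) = 1 /\
  (forall F F' : repfun k G, zeta (rmul F F') = zeta F * zeta F') /\
  (forall (u : BB k G) (F : repfun k G),
     zeta (rmul (BB_repfun u) F) = BB_total u * zeta F) /\
  injective (@zeta k G) /\
  @iota_star k G \o @zeta k G = @reps k G /\
  (forall (E : rep k G) (f : dsect E) (p : sect E) (g : arrow G),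
     zeta (antipode (cls f p)) g = zeta (cls f p) (arrow_inv g)) /\
  (forall (x y z : ob G) (f : ghom x y) (g : ghom y z) (F : repfun k G)
      (l : seq (repfun k G * repfun k G)),
     Delta F = rtens_sum l ->
     zeta F (Arrow (gcmp g f)) =
       \sum_(u <- l) zeta u.1 (Arrow g) * zeta u.2 (Arrow f)).
Proof.
split; first exact: zeta_cls.
split; first exact: zetaD.
split; first exact: zeta1.
split; first exact: zetaM.
split; first by move=> u F; rewrite zetaM zeta_BB.
split; first exact: zeta_inj.
split; first by apply: funext => F; apply: zeta_id.
split; first by move=> E f p g; apply: zeta_antipode.
by move=> x y z f g F l e; rewrite -zeta2_Delta e zeta2_sum.
Qed.
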